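(* Let $f$ be a non-square positive integer with $\sqrt{f}=[\,a_0;\overline{a_1,\dots,a_n,2a_0}\,]$ where $n$ is even (odd period length $n+1$), and let $(c,h)$ be the smallest pair of positive integers with $c^2-fh^2=1$. Let $f(t)=(c+1)^2h^2t^2+2(c^2-1)t+f$. Then for every integer $t\ge 0$, $$\sqrt{f(t)}=[\,(c+1)ht+a_0;\overline{a_1,\dots,a_n,2(c+1)ht+2a_0}\,],$$ and $$X=\frac{(c+1)^2}{c-1}h^4t^2+2(c+1)h^2t+c,\qquad Y=\frac{c+1}{c-1}h^3t+h$$ is the fundamental solution (smallest solution in positive integers) of $X^2-f(t)Y^2=1$.
   Context: $[\,b_0;\overline{b_1,\dots,b_k}\,]$ denotes the simple periodic continued fraction with the overlined block repeating. The fundamental solution of $X^2-DY^2=1$ is its smallest solution in positive integers. *)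

(* Defs.v *)
From mathcomp Require Import all_boot all_order all_algebra.
From mathcomp Require Import all_classical all_reals all_analysis.
Import Order.TTheory GRing.Theory Num.Theory.
Import numFieldNormedType.Exports.

Set Implicit Arguments.
Unset Strict Implicit.
Unset Printing Implicit Defensive.

Local Open Scope classical_set_scope.
Local Open Scope ring_scope.

(* The finite continued fraction b + 1/(s_0 + 1/(s_1 + ...)). *)
Fixpoint cf_finite (R : realType) (b : int) (s : seq int) : R :=
  if s is b' :: s' then b%:~R + (cf_finite R b' s')^-1 else b%:~R.

(* The purely periodic sequence obtained by repeating the block s; it is
   meaningful only for s != [::]. *)
Definition repeat_block (s : seq int) (j : nat) : int :=
  nth 0 s (j %% size s)%N.

Definition cf_convergent (R : realType) (b : int) (s : seq int) (m : nat) : R :=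
  cf_finite R b (mkseq (repeat_block s) m).

(* x = [b; s, s, s, ...] as a simple continued fraction: the partial quotients
   after the first are positive integers and the convergents tend to x.
   The block s is not required to be as short as possible. *)
Definition is_periodic_cf (R : realType) (x : R) (b : int) (s : seq int) : Prop :=
  [/\ s != [::],
      (forall q : int, q \in s -> 0 < q)
    & cf_convergent R b s @ \oo --> x].

Definition minimal_block (s : seq int) : Prop :=
  forall d : nat, (0 < d)%N ->
    (forall j, repeat_block s (j + d)%N = repeat_block s j) -> (size s <= d)%N.

Definition pell_solution (D x y : int) : Prop :=
  [/\ 0 < x, 0 < y & x ^+ 2 - D * y ^+ 2 = 1].

(* For D > 0 the two coordinates of positive solutions increase together, so
   the smallest solution is smallest in both. *)
Definition fundamental_solution (D x y : int) : Prop :=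
  pell_solution D x y /\
  forall x' y' : int, pell_solution D x' y' -> x <= x' /\ y <= y'.

Definition pell_family (f c h t : int) : int :=
  (c + 1) ^+ 2 * h ^+ 2 * t ^+ 2 + 2 * (c ^+ 2 - 1) * t + f.

(* Main.v *)
(** Let s = (2 a_0, a_1, ..., a_n); the number sqrt f + a_0 is fixed by the
Moebius map of s, which forces the matrix of s to be that of multiplication by
p + q sqrt f, and the odd length of s gives p^2 - f q^2 = -1.
Multiplication by c + h sqrt f has a nonnegative matrix of determinant 1,
so it is the matrix of a word w of even length; uniqueness of continued
fractions yields s w = w s, and minimality of the period makes w a power of s,
with exponent at least 2 by parity.  Hence c + h sqrt f = (p + q sqrt f)^2, that is,
c = 2 p^2 + 1 and h = 2 p q.
With T = (c + 1) h t the pair (p + T q, q) solves X^2 - f(t) Y^2 = -1, and the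
same Moebius map, with a_0 shifted by T, fixes sqrt (f(t)) + T + a_0.  For t > 0
the first coordinate is so large (at least q^2) that no solution of the negative
equation has a smaller second coordinate, and squaring gives the fundamental
solution of the positive equation. *)
Require Import Defs.
From mathcomp Require Import all_boot all_order all_algebra.
From mathcomp Require Import all_classical all_reals all_analysis.
From mathcomp Require Import zify ring lra.
Import Order.TTheory GRing.Theory Num.Theory.
Import numFieldNormedType.Exports.

Set Implicit Arguments.
Unset Strict Implicit.
Unset Printing Implicit Defensive.

Local Open Scope classical_set_scope.
Local Open Scope ring_scope.

(** * Words of partial quotients and their integer matrices *)

(* cf_act s v = M v, where M is the product of the matrices [[b, 1], [1, 0]] for
   b in s; its columns are cf_act s (1, 0) and cf_act s (0, 1). *)
Definition cf_act (s : seq int) (v : int * int) : int * int :=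
  foldr (fun b w => (b * w.1 + w.2, w.1)) v s.

(* [b_0; b_1, ..., b_k, y] for s = b_0 ... b_k: unlike in cf_finite, the last
   entry is real and the first one is not separated. *)
Definition cf_eval (R : realType) (s : seq int) (y : R) : R :=
  foldr (fun b z => b%:~R + z^-1) y s.

Definition pos_word (s : seq int) : bool := all (fun b : int => 0 < b) s.

Lemma cf_act_cat (s r : seq int) (v : int * int) :
  cf_act (s ++ r) v = cf_act s (cf_act r v).
Proof. exact: foldr_cat. Qed.

Lemma cf_act_linear (s : seq int) (x y : int) :
  cf_act s (x, y) =
    ((cf_act s (1, 0)).1 * x + (cf_act s (0, 1)).1 * y,
     (cf_act s (1, 0)).2 * x + (cf_act s (0, 1)).2 * y).
Proof.
elim: s => [|b s IHs] /=; first by congr pair; ring.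
by rewrite IHs /=; congr pair; ring.
Qed.

Lemma cf_act_det (s : seq int) :
  (cf_act s (1, 0)).1 * (cf_act s (0, 1)).2
  - (cf_act s (0, 1)).1 * (cf_act s (1, 0)).2 = (-1) ^+ size s.
Proof.
elim: s => [|b s IHs] /=; first by rewrite expr0; ring.
by rewrite exprS -IHs; ring.
Qed.

Lemma cf_act_ge0 (s : seq int) (x y : int) :
  pos_word s -> 0 <= x -> 0 <= y ->
  0 <= (cf_act s (x, y)).1 /\ 0 <= (cf_act s (x, y)).2.
Proof.
move=> + x0 y0; elim: s => [|b s IHs] //= /andP[b0 /IHs[u0 v0]].
by split=> //; rewrite addr_ge0 // mulr_ge0 // ltW.
Qed.

Lemma cf_act10_ge1 (s : seq int) : pos_word s -> 1 <= (cf_act s (1, 0)).1.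
Proof.
elim: s => [|b s IHs] //= /andP[b0 sp].
have [_] := @cf_act_ge0 s 1 0 sp isT (lexx 0); have := IHs sp.
by case: (cf_act s (1, 0)) => u v /=; nia.
Qed.

(* Euclid's algorithm on the first column; when it reaches C = E = 1 the last
   quotient has to be split as B + 1/1. *)
Lemma cf_act_surj (A B C E : int) :
  B <= A -> C <= A -> E <= B -> E <= C -> 0 <= E -> 1 <= C ->
  A * E - B * C = 1 \/ A * E - B * C = -1 ->
  exists s, [/\ pos_word s, s != [::],
    cf_act s (1, 0) = (A, C) & cf_act s (0, 1) = (B, E)].
Proof.
have [k] := ubnP `|C|%N; elim: k A B C E => // k IHk A B C E leCk BA CA EB EC E0 C1 det.
have [C_1|C_neq1] := eqVneq C 1.
  have [E_0|E_neq0] := eqVneq E 0.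
    exists [:: A]; subst C E; split=> //=; first by rewrite andbT; lia.
      by congr pair; ring.
    by congr pair; lia.
  have E_1 : E = 1 by lia.
  exists [:: B; 1]; subst C E; split=> //=.
  - by rewrite !andbT; lia.
  - by congr pair; lia.
  - by congr pair; lia.
(* One Euclidean step removes [b] copies of the row [(C, E)] from [(A, B)]. The determinant only
   changes sign; being 1 or -1, it forces the order relations on [A'] and [B']. *)
pose b := (A %/ C)%Z; pose A' := (A %% C)%Z; pose B' := B - b * E.
have C0 : C != 0 by lia.
have AE : A = b * C + A' by exact: divz_eq.
have A'0 : 0 <= A' by exact: modz_ge0.
have A'C : A' < C by apply: ltz_pmod; lia.
have b1 : 1 <= b by nia.
have BE : B = b * E + B' by rewrite /B'; ring.
have det' : C * B' - E * A' = 1 \/ C * B' - E * A' = -1.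
  by move: det; rewrite AE BE => -[] d; [right|left]; nia.
clearbody A' B' b.
have A'E : A' * E <= (C - 1) * E by rewrite ler_wpM2r //; lia.
have B'0 : 0 <= B'.
  by rewrite leNgt; apply/negP => H; have : 0 <= E * A' by [exact: mulr_ge0]; nia.
have A'1 : 1 <= A'.
  rewrite leNgt; apply/negP => H; have A'_0 : A' = 0 by lia.
  have CB' : 2 * B' <= C * B' by rewrite ler_wpM2r //; lia.
  move: det'; rewrite A'_0 mulr0 subr0 => det'.
  have B'_0 : B' = 0 by lia.
  by move: det'; rewrite B'_0 mulr0; lia.
have B'E : B' <= E.
  rewrite leNgt; apply/negP => H.
  by have : C * (E + 1) <= C * B' by [rewrite ler_pM2l; lia]; nia.
have B'A' : B' <= A'.
  rewrite leNgt; apply/negP => H.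
  have : C * (A' + 1) <= C * B' by rewrite ler_pM2l; lia.
  by have : E * A' <= C * A' by [rewrite ler_wpM2r]; nia.
have lt_k : (`|A'| < k)%N by lia.
have [s [sp sN s1 s2]] := IHk C E A' B' lt_k EC (ltW A'C) B'E B'A' B'0 A'1 det'.
exists (b :: s); split=> //=.
- by rewrite sp andbT; lia.
- by rewrite s1 /= -AE.
- by rewrite s2 /= -BE.
Qed.

(** * Commuting words and primitive blocks *)

(** Strip [s] from the front of [r] while it fits. A shorter nonempty [r] would give [s = r ++ s']
    with [r] and [s'] commuting, hence a proper rotation fixing [s]. *)
Lemma comm_cat_primitive (T : eqType) (s r : seq T) :
  (0 < size s)%N -> (forall d, (0 < d < size s)%N -> rot d s != s) ->
  s ++ r = r ++ s -> exists k, r = flatten (nseq k s).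
Proof.
move=> s_gt0 prim; have [m] := ubnP (size r); elim: m r => // m IHm r lerm E.
have [le_sr|lt_rs] := leqP (size s) (size r).
  have [r' Er] : exists r', r = s ++ r'.
    exists (drop (size s) r).
    have := congr1 (take (size s)) E; rewrite take_size_cat // takel_cat // => Es.
    by rewrite -[LHS](cat_take_drop (size s)) -Es.
  have [||k Ek] := IHm r'.
  - by move: lerm; rewrite Er size_cat; lia.
  - by move: E; rewrite Er -catA => /eqP; rewrite eqseq_cat // eqxx => /eqP.
  by exists k.+1; rewrite Er Ek.
have [r0|r_gt0] := posnP (size r); first by exists 0; apply: size0nil.
have /negP[] := prim (size r) ltac:(by rewrite r_gt0).
have [s' Es] : exists s', s = r ++ s'.
  exists (drop (size r) s); have := congr1 (take (size r)) E.
  rewrite takel_cat ?(ltnW lt_rs) // take_size_cat // => Er.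
  by rewrite -[LHS](cat_take_drop (size r)) Er.
move: E; rewrite Es -catA => /eqP; rewrite eqseq_cat // eqxx => /eqP E.
by rewrite rot_size_cat E.
Qed.

Lemma nth_rot (T : Type) (x0 : T) (s : seq T) (d i : nat) :
  (d <= size s)%N -> (i < size s)%N ->
  nth x0 (rot d s) i = nth x0 s ((i + d) %% size s)%N.
Proof.
move=> ds lt_i; rewrite nth_cat size_drop nth_drop.
case: ltnP => H; first by rewrite modn_small addnC //; lia.
have le_sid : (size s <= i + d)%N by lia.
rewrite -[in RHS](subnK le_sid) modnDr modn_small; last by lia.
by rewrite nth_take; [congr nth; lia|lia].
Qed.

Lemma minimal_block_rot (s : seq int) (d : nat) :
  minimal_block s -> (0 < d < size s)%N -> rot d s != s.
Proof.
move=> smin /andP[d0 ds]; apply/negP => /eqP E.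
suff : (size s <= d)%N by rewrite leqNgt ds.
apply: smin => // j; rewrite /repeat_block -modnDml -nth_rot ?E ?(ltnW ds) //.
by rewrite ltn_mod; exact: leq_trans ds.
Qed.

(** * Irrationality of the root and the negative Pell equation *)

Lemma nonsquare_lin_indep (R : realType) (f u v : int) :
  0 < f -> ~ (exists m : int, f = m ^+ 2) ->
  u%:~R + v%:~R * Num.sqrt (f%:~R : R) = 0 -> v = 0.
Proof.
move=> f0 fns E; apply/eqP; apply/negPn/negP => v0; apply: fns.
have E2 : u ^+ 2 = f * v ^+ 2.
  apply/eqP; rewrite -(eqr_int R) !expr2 !rmorphM /=; apply/eqP.
  have -> : u%:~R = - (v%:~R * Num.sqrt (f%:~R : R)).
    by apply/eqP; rewrite -addr_eq0 E.
  by rewrite mulrNN mulrACA -(expr2 (Num.sqrt _)) sqr_sqrtr ?ler0z ?(ltW f0) // mulrC.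
have /dvdzP[m Em] : (v %| u)%Z.
  by rewrite -(@dvdz_pexp2r _ _ 2) // E2 dvdz_mull.
exists m; move: E2; rewrite Em exprMn => /mulIf -> //.
by rewrite expf_neq0.
Qed.

(* (P v - u Q)(P v + u Q) = Q^2 - v^2, whose left-hand side is too large if v < Q. *)
Lemma neg_pell_min (D P Q u v : int) :
  0 < Q -> Q ^+ 2 <= P -> P ^+ 2 - D * Q ^+ 2 = -1 ->
  0 <= u -> 0 < v -> u ^+ 2 - D * v ^+ 2 = -1 -> Q <= v.
Proof.
move=> Q0 QP PQ u0 v0 uv; rewrite leNgt; apply/negP => vQ.
have E : (P * v - u * Q) * (P * v + u * Q) = Q ^+ 2 - v ^+ 2.
  have -> : (P * v - u * Q) * (P * v + u * Q) = P ^+ 2 * v ^+ 2 - u ^+ 2 * Q ^+ 2 by ring.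
  have -> : P ^+ 2 = D * Q ^+ 2 - 1 by lia.
  have -> : u ^+ 2 = D * v ^+ 2 - 1 by lia.
  by ring.
have P0 : 0 < P by apply: lt_le_trans QP; rewrite exprn_gt0.
have S0 : P * 1 <= P * v + u * Q.
  by rewrite -[P * 1]addr0 lerD ?ler_pM2l ?mulr_ge0 // ltW.
have S1 : 0 < P * v + u * Q by apply: lt_le_trans S0; rewrite mulr1.
have d1 : 0 < P * v - u * Q.
  rewrite -(pmulr_lgt0 _ S1).
  by rewrite E subr_gt0 ltrXn2r ?ltW.
have : P * v + u * Q <= Q ^+ 2 - v ^+ 2.
  by rewrite -E ler_peMl ?(ltW S1) // -gtz0_ge1.
have : 0 < v ^+ 2 by rewrite exprn_gt0.
lia.
Qed.

(** The claimed pair is the square of [P + Q sqrt D]. Dividing any solution by [P + Q sqrt D] leaves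
    [u + v sqrt D] of norm -1 with [u >= P] and [v >= Q]; multiplying back gives the bounds. *)
Lemma neg_pell_fundamental (D P Q : int) :
  0 < Q -> Q ^+ 2 <= P -> P ^+ 2 - D * Q ^+ 2 = -1 ->
  fundamental_solution D (2 * P ^+ 2 + 1) (2 * P * Q).
Proof.
move=> Q0 QP PQ; have P0 : 0 < P by nia.
have DQ : D * Q ^+ 2 = P ^+ 2 + 1 by lia.
split.
  split; [nia|nia|].
  have -> : D * (2 * P * Q) ^+ 2 = 4 * P ^+ 2 * (D * Q ^+ 2) by ring.
  by rewrite DQ; ring.
move=> x y [x0 y0 xy].
(* u + v sqrt D = (x + y sqrt D) / (P + Q sqrt D). *)
pose u := D * y * Q - x * P; pose v := x * Q - y * P.
have Ex : x = u * P + D * v * Q.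
  have -> : u * P + D * v * Q = x * (D * Q ^+ 2 - P ^+ 2) by rewrite /u /v; ring.
  by rewrite DQ; ring.
have Ey : y = u * Q + v * P.
  have -> : u * Q + v * P = y * (D * Q ^+ 2 - P ^+ 2) by rewrite /u /v; ring.
  by rewrite DQ; ring.
have uv : u ^+ 2 - D * v ^+ 2 = -1.
  have -> : u ^+ 2 - D * v ^+ 2 = (x ^+ 2 - D * y ^+ 2) * (P ^+ 2 - D * Q ^+ 2).
    by rewrite /u /v; ring.
  by rewrite xy PQ; ring.
have v0 : 0 < v.
  have E : v * (x * Q + y * P) = Q ^+ 2 + y ^+ 2.
    have -> : v * (x * Q + y * P) = x ^+ 2 * Q ^+ 2 - y ^+ 2 * P ^+ 2.
      by rewrite /v; ring.
    have -> : x ^+ 2 = D * y ^+ 2 + 1 by lia.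
    have -> : P ^+ 2 = D * Q ^+ 2 - 1 by lia.
    by ring.
  have : 0 < x * Q + y * P by rewrite addr_gt0 ?mulr_gt0.
  have : 0 < Q ^+ 2 + y ^+ 2 by rewrite addr_gt0 ?exprn_gt0.
  by rewrite -E => + H; rewrite pmulr_lgt0.
(* The sign of [u] is still open, hence the absolute value. *)
have Qv : Q <= v.
  apply: (@neg_pell_min D P Q `|u| v) => //.
  by rewrite real_normK ?num_real.
have D0 : 0 < D.
  by rewrite -(@pmulr_lgt0 _ (Q ^+ 2)) ?exprn_gt0 // DQ ltr_wpDl ?sqr_ge0.
have Pu : P <= `|u|.
  rewrite -(@ler_pXn2r _ 2) ?nnegrE ?(ltW P0) ?normr_ge0 // real_normK ?num_real //.
  have -> : u ^+ 2 = D * v ^+ 2 - 1 by lia.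
  have -> : P ^+ 2 = D * Q ^+ 2 - 1 by lia.
  by rewrite lerD2r ler_pM2l // ler_pXn2r // nnegrE ltW.
(* If [u < 0], then [Q <= v] yields [v P <= - u Q], so [y = u Q + v P] would not be positive. *)
have [u0|u0] := leP 0 u; last first.
  exfalso; have : (v * P) ^+ 2 <= (- u * Q) ^+ 2.
    rewrite !exprMn sqrrN.
    have -> : u ^+ 2 = D * v ^+ 2 - 1 by lia.
    have -> : P ^+ 2 = D * Q ^+ 2 - 1 by lia.
    rewrite mulrBr mulrBl mul1r mulr1 mulrCA mulrA lerD2l lerN2.
    by rewrite ler_pXn2r // nnegrE ltW.
  rewrite leNgt ltr_pXn2r ?nnegrE ?mulr_ge0 ?oppr_ge0 ?(ltW u0) ?(ltW v0) ?(ltW P0) ?(ltW Q0) //.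
  by move=> /negP; apply; lia.
have {}Pu : P <= u by rewrite -(ger0_norm u0).
have DvQ : D * Q * Q <= D * v * Q by rewrite ler_pM2r // ler_pM2l.
have uP : P * P <= u * P by rewrite ler_pM2r.
have uQ : P * Q <= u * Q by rewrite ler_pM2r.
have vP : Q * P <= v * P by rewrite ler_pM2r.
by split; [rewrite Ex; lia | rewrite Ey; lia].
Qed.

(** * Continued fractions with a real last entry *)

Definition irrational_num (R : realType) (x : R) : Prop :=
  forall u v : int, u%:~R + v%:~R * x = 0 -> v = 0.

Lemma cf_eval_cat (R : realType) (s r : seq int) (y : R) :
  cf_eval (s ++ r) y = cf_eval s (cf_eval r y).
Proof. exact: foldr_cat. Qed.

Lemma cf_eval_ge1 (R : realType) (s : seq int) (y : R) :
  pos_word s -> 1 <= y -> 1 <= cf_eval s y.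
Proof.
move=> + y1; elim: s => [|b s IHs] //= /andP[b0 /IHs z1].
have : 0 < (cf_eval s y)^-1 by rewrite invr_gt0; lra.
have : (1%:~R : R) <= b%:~R by rewrite ler_int; lia.
lra.
Qed.

Lemma cf_eval_gt1 (R : realType) (s : seq int) (y : R) :
  pos_word s -> 1 < y -> 1 < cf_eval s y.
Proof.
case: s => [|b s] //= /andP[b0 sp] /ltW y1.
have z1 := cf_eval_ge1 sp y1.
have : 0 < (cf_eval s y)^-1 by rewrite invr_gt0; lra.
have : (1%:~R : R) <= b%:~R by rewrite ler_int; lia.
lra.
Qed.

(** All tails exceed 1, so the leading entry is the integer part and the words agree entry by
    entry. *)
Lemma cf_eval_inj (R : realType) (s r : seq int) (y : R) :
  pos_word s -> pos_word r -> 1 < y -> size s = size r ->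
  cf_eval s y = cf_eval r y -> s = r.
Proof.
move=> + + y1; elim: s r => [|b s IHs] [|d r] //= /andP[_ sp] /andP[_ rp] [szE] E.
have inv01 (z : R) : 1 < z -> 0 < z^-1 < 1.
  by move=> z1; rewrite invr_gt0 invf_lt1; lra.
have /andP[? ?] := inv01 _ (cf_eval_gt1 sp y1).
have /andP[? ?] := inv01 _ (cf_eval_gt1 rp y1).
have bd : b = d.
  suff : (b < d + 1) && (d < b + 1) by lia.
  rewrite -2!(ltr_int R) !rmorphD /=; apply/andP; split; lra.
rewrite bd (IHs r) //; apply: invr_inj; apply: (addrI (b%:~R)).
by rewrite E bd.
Qed.

Lemma cf_evalE (R : realType) (s : seq int) (y : R) :
  pos_word s -> 1 <= y ->
  cf_eval s y * ((cf_act s (1, 0)).2%:~R * y + (cf_act s (0, 1)).2%:~R) =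
  (cf_act s (1, 0)).1%:~R * y + (cf_act s (0, 1)).1%:~R.
Proof.
move=> + y1; elim: s => [|b s IHs] /=; first by move=> _; ring.
move=> /andP[b0 sp]; have z1 := cf_eval_ge1 sp y1; have z0 : cf_eval s y != 0 by lra.
rewrite !intrD !intrM mulrDl -[X in _^-1 * X](IHs sp) mulKf //; ring.
Qed.

(** After [r^2 = f] the fixed-point equation is linear in [r], so both coefficients vanish. The
    result says that [(r + a0, 1)] is an eigenvector with eigenvalue [p + q r], where [q] is the
    lower left entry and [p] is [a0 q] plus the lower right one. *)
Lemma cf_eval_quad (R : realType) (f a0 : int) (r : R) (s : seq int) :
  irrational_num r -> r ^+ 2 = f%:~R -> 1 <= r + a0%:~R -> pos_word s ->
  cf_eval s (r + a0%:~R) = r + a0%:~R ->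
  (cf_act s (1, 0)).1 = 2 * a0 * (cf_act s (1, 0)).2 + (cf_act s (0, 1)).2 /\
  (cf_act s (0, 1)).1 = (f - a0 ^+ 2) * (cf_act s (1, 0)).2.
Proof.
move=> rI r2 y1 sp sy; have := cf_evalE sp y1; rewrite sy.
case: (cf_act s (1, 0)) (cf_act s (0, 1)) => [A C] [B E] /= eqAE.
have E0 : (C * f + C * a0 ^+ 2 + E * a0 - A * a0 - B)%:~R
          + (2 * a0 * C + E - A)%:~R * r = 0.
  rewrite expr2 !(rmorphB, rmorphD, rmorphM) /= -r2.
  move/eqP: eqAE; rewrite -subr_eq0 => /eqP <-; ring.
have E1 := rI _ _ E0.
have AE : A = 2 * a0 * C + E by lia.
split=> //.
move: E0; rewrite E1 mul0r addr0 => /eqP; rewrite intr_eq0 AE => /eqP.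
by lia.
Qed.

Lemma cf_eval_fix (R : realType) (f a0 : int) (r : R) (s : seq int) :
  r ^+ 2 = f%:~R -> 1 <= r + a0%:~R -> pos_word s -> s != [::] ->
  (cf_act s (1, 0)).1 = 2 * a0 * (cf_act s (1, 0)).2 + (cf_act s (0, 1)).2 ->
  (cf_act s (0, 1)).1 = (f - a0 ^+ 2) * (cf_act s (1, 0)).2 ->
  cf_eval s (r + a0%:~R) = r + a0%:~R.
Proof.
move=> r2 y1 sp sN; have := cf_evalE sp y1.
have [_ E0] := @cf_act_ge0 s 0 1 sp (lexx _) isT.
have C1 : 1 <= (cf_act s (1, 0)).2.
  by case: s sp sN {y1 E0} => //= b s /andP[_ /cf_act10_ge1].
move: E0 C1; case: (cf_act s (1, 0)) (cf_act s (0, 1)) => [A C] [B E] /= E0 C1.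
move=> eqAE AE BE.
have den0 : C%:~R * (r + a0%:~R) + E%:~R != 0.
  have : 0 <= E%:~R :> R by rewrite ler0z.
  have : 1%:~R <= C%:~R :> R by rewrite ler_int.
  move: (C%:~R) (E%:~R) => c e; nra.
apply: (mulIf den0); rewrite eqAE AE BE.
by rewrite expr2 !(rmorphB, rmorphD, rmorphM) /= -r2; ring.
Qed.

(** * Convergence of periodic continued fractions *)

(* If d <= 1 / k and u, v >= 1 are at distance d then u v >= 1 + d, and
   d / (1 + d) <= 1 / (k + 1). *)
Lemma inv_dist_harmonic (R : realType) (k : nat) (u v : R) :
  1 <= u -> 1 <= v -> `|u - v| <= harmonic k -> `|u^-1 - v^-1| <= harmonic k.+1.
Proof.
wlog uv : u v / u <= v => [W u1 v1 H|].
  have [uv|/ltW vu] := leP u v; first exact: W.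
  by rewrite distrC; apply: W => //; rewrite distrC.
move=> u1 v1; rewrite distrC ger0_norm ?subr_ge0 // => H.
rewrite ger0_norm ?subr_ge0 ?lef_pV2 ?posrE; try lra.
have k0 : (0 : R) < k.+1%:R by rewrite ltr0n.
have -> : u^-1 - v^-1 = (v - u) / (u * v) by field; apply/andP; split; lra.
move: H => /= H.
have {}H : (v - u) * k.+1%:R <= 1 by rewrite -ler_pdivlMr // mul1r.
rewrite ler_pdivrMr; last by nra.
rewrite mulrC ler_pdivlMr ?ltr0n // -[k.+2%:R]natr1.
by nra.
Qed.

Lemma cf_eval_dist (R : realType) (s : seq int) (y z : R) :
  pos_word s -> 1 <= y -> 1 <= z -> `|y - z| <= 1 ->
  `|cf_eval s y - cf_eval s z| <= harmonic (size s).
Proof.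
move=> + y1 z1 yz; elim: s => [_|b s IHs]; first by rewrite /= invr1.
move=> /= /andP[_ sp]; rewrite opprD addrACA subrr add0r.
by apply: inv_dist_harmonic; [exact: cf_eval_ge1 | exact: cf_eval_ge1 | exact: IHs].
Qed.

Lemma mkseq_repeat_block (s : seq int) (m : nat) :
  mkseq (repeat_block s) (size s + m) = s ++ mkseq (repeat_block s) m.
Proof.
apply: (@eq_from_nth _ 0) => [|i]; first by rewrite size_cat !size_mkseq.
rewrite size_mkseq => lt_i; rewrite nth_mkseq // nth_cat /repeat_block.
case: ltnP => lt_is; first by rewrite modn_small.
rewrite nth_mkseq; last by rewrite ltn_subLR.
by rewrite -{1}(subnK lt_is) modnDr.
Qed.

Lemma cf_finite_cat (R : realType) (b e : int) (s r : seq int) :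
  cf_finite R b (s ++ e :: r) = cf_eval (b :: s) (cf_finite R e r).
Proof. by elim: s b => [|d s IHs] b //=; rewrite IHs. Qed.

Lemma pos_word_mkseq (s : seq int) (m : nat) :
  pos_word s -> s != [::] -> pos_word (mkseq (repeat_block s) m).
Proof.
move=> /allP sp sN; apply/allP => b /mapP[i _ ->]; apply: sp.
by apply: mem_nth; rewrite ltn_mod lt0n size_eq0.
Qed.

(** If [y0] is the tail of [x] after [b], then [y = e + 1 / y0]. So [y0] is fixed by the block, and
    [x] shares ever more entries with its convergents. *)
Lemma is_periodic_cf_intro (R : realType) (b e : int) (a : seq int) (x y : R) :
  pos_word (rcons a e) -> 1 < y -> x = cf_eval (b :: a) y ->
  y = x - b%:~R + e%:~R -> is_periodic_cf x b (rcons a e).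
Proof.
move=> sp y1 xE yE; have ap : pos_word a by move: sp; rewrite /pos_word all_rcons => /andP[].
set s := rcons a e in sp *.
have sN : s != [::] by rewrite -size_eq0 size_rcons.
split=> //; first by move=> q qs; apply: (allP sp).
set g := repeat_block s; pose y0 := cf_eval a y.
have y01 : 1 <= y0 by apply: cf_eval_ge1 => //; exact: ltW.
have sy0 : cf_eval s y0 = y0.
  rewrite /s -cats1 cf_eval_cat /=; congr cf_eval.
  by rewrite yE xE /=; ring.
have gy0 k : cf_eval (mkseq g (k * size s)) y0 = y0.
  by elim: k => // k IHk; rewrite mulSn mkseq_repeat_block cf_eval_cat IHk.
rewrite -cvg_shiftS; apply/cvgrPdist_le => eps eps0.
have /cvgr0Pnorm_le/(_ _ eps0) := @cvg_harmonic R.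
apply: filterS => m; rewrite ger0_norm ?harmonic_ge0 // => le_eps.
apply: le_trans le_eps.
have le_harm : harmonic m.+1 <= harmonic m :> R.
  by rewrite /= lef_pV2 ?posrE ?ltr0n // ler_nat.
apply: le_trans le_harm.
(* A block is nonempty, so [m + 1] blocks reach past the entry [g m]. *)
have [r rE] : exists r, mkseq g (m.+1 * size s) = mkseq g m ++ g m :: r.
  have szs : (0 < size s)%N by rewrite lt0n size_eq0.
  have -> : (m.+1 * size s = m + (m.+1 * size s - m.+1).+1)%N by nia.
  by exists (map g (iota m.+1 (m.+1 * size s - m.+1))); rewrite /mkseq iotaD map_cat.
have : pos_word (mkseq g (m.+1 * size s)) by exact: pos_word_mkseq.
rewrite rE /pos_word all_cat => /andP[gp /= /andP[g0 rp]].
have gy : y0 = cf_eval (mkseq g m) ((g m)%:~R + (cf_eval r y0)^-1).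
  by rewrite -{1}(gy0 m.+1) rE cf_eval_cat.
have r1 : 1 <= cf_eval r y0 by exact: cf_eval_ge1.
have r_inv : 0 < (cf_eval r y0)^-1 <= 1 by rewrite invr_gt0 invf_le1; lra.
have g1 : 1 <= (g m)%:~R :> R by rewrite (ler_int R 1) -gtz0_ge1.
have -> : cf_convergent R b s m.+1 = cf_eval (b :: mkseq g m) (g m)%:~R.
  by rewrite /cf_convergent -addn1 /mkseq iotaD map_cat /= cf_finite_cat.
(* The same [m] entries act on [g m + 1 / z] and on [g m], which are at distance at most 1. *)
rewrite xE /= opprD addrACA subrr add0r -/y0 gy.
apply: inv_dist_harmonic; [by apply: cf_eval_ge1 => //; lra | exact: cf_eval_ge1 |].
rewrite -[X in harmonic X](size_mkseq g m).
apply: cf_eval_dist => //; first lra.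
by rewrite addrC addKr ger0_norm; lra.
Qed.

(** Entries are peeled off one by one: an irrational limit differs from the integer entry, so
    inversion is continuous there, and the new limit is again irrational. *)
Lemma cvg_cf_tail (R : realType) (b e : int) (s : seq int) (r : nat -> seq int) (x : R) :
  irrational_num x ->
  (fun m => cf_finite R b (s ++ e :: r m)) @ \oo --> x ->
  exists2 y, x = cf_eval (b :: s) y & (fun m => cf_finite R e (r m)) @ \oo --> y.
Proof.
have step d (u : nat -> R) z : irrational_num z ->
    (fun m => d%:~R + (u m)^-1) @ \oo --> z ->
    irrational_num (z - d%:~R)^-1 /\ u @ \oo --> (z - d%:~R)^-1.
  move=> zI uz.
  have zd : z - d%:~R != 0.
    apply/eqP => E; have : (1 : int) = 0.
      by apply: (zI (- d)); rewrite rmorphN /= mul1r addrC.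
    by [].
  split.
    move=> k l E; have E2 : k%:~R * (z - d%:~R) + l%:~R = 0.
      by rewrite -[l%:~R](mulfVK zd) -mulrDl E mul0r.
    have k0 : k = 0.
      by apply: (zI (l - k * d)); rewrite -[RHS]E2 rmorphB rmorphM /=; ring.
    by move/eqP: E2; rewrite k0 mul0r add0r intr_eq0 => /eqP.
  apply/cvgVP; first by rewrite invr_eq0.
  rewrite invrK.
  rewrite [X in X @ _ --> _](_ : _ = (fun m => d%:~R + (u m)^-1) - cst d%:~R).
    by apply: cvgB => //; exact: cvg_cst.
  by apply/funext => m; rewrite /= !fctE addrC addKr.
elim: s b x => [|b' s IHs] b x xI /= /(step _ _ _ xI) [yI uy].
  by exists (x - b%:~R)^-1 => //; rewrite invrK addrC subrK.
have [y yE ycv] := IHs _ _ yI uy.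
by exists y => //; move: yE => /= <-; rewrite invrK addrC subrK.
Qed.

(** After [a0] and [a] the expansion continues with [2 a0] and the block, which is the original
    expansion with its first entry raised by [a0]; its limit is therefore [r + a0]. *)
Lemma cf_sqrt_fix (R : realType) (r : R) (a0 : int) (a : seq int) :
  irrational_num r -> is_periodic_cf r a0 (rcons a (2 * a0)) ->
  r = cf_eval (a0 :: a) (r + a0%:~R).
Proof.
move=> rI [_ _]; set s := rcons a _; rewrite -(cvg_shiftn (size s)) => cv.
have conv m : cf_finite R (2 * a0) (mkseq (repeat_block s) m) =
    cf_convergent R a0 s m + a0%:~R.
  by case: m => [|m]; rewrite /cf_convergent /= intrM; ring.
have [y rE ycv] : exists2 y, r = cf_eval (a0 :: a) y &
    (fun m => cf_finite R (2 * a0) (mkseq (repeat_block s) m)) @ \oo --> y.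
  apply: cvg_cf_tail => //; move: cv; rewrite [X in X @ _ --> _](_ : _ = fun m =>
    cf_finite R a0 (a ++ 2 * a0 :: mkseq (repeat_block s) m)) //.
  apply/funext => m /=.
  by rewrite /cf_convergent addnC mkseq_repeat_block cat_rcons.
rewrite {1}rE; congr cf_eval; move: ycv; under eq_fun do rewrite conv.
move=> /(@cvg_unique _ (@norm_hausdorff _ R)); apply.
by apply: cvgD; [move: cv; rewrite cvg_shiftn | exact: cvg_cst].
Qed.

(** * The fundamental solution as the square of the period unit *)

(** The matrix is that of multiplication by [c + h sqrt f]. Since [a0] is the integer part of
    [sqrt f], [a0 h <= c <= (a0 + 1) h], which orders its entries as [cf_act_surj] requires. *)
Lemma pell_unit_word (f a0 c h : int) :
  1 <= a0 -> a0 ^+ 2 < f -> f < (a0 + 1) ^+ 2 -> pell_solution f c h ->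
  exists w, [/\ pos_word w, w != [::], cf_act w (1, 0) = (c + a0 * h, h)
    & cf_act w (0, 1) = ((f - a0 ^+ 2) * h, c - a0 * h)].
Proof.
move=> a01 lf fu [c0 h0 ch].
have c2 : c ^+ 2 = f * h ^+ 2 + 1 by lia.
have h2 : 0 < h ^+ 2 by rewrite exprn_gt0.
have le_c : a0 * h <= c.
  rewrite -(@ler_pXn2r _ 2) ?nnegrE ?mulr_ge0 ?(ltW c0) ?(ltW h0) //; last lia.
  rewrite exprMn c2 (@le_trans _ _ (f * h ^+ 2)) ?ler_pM2r ?(ltW lf) //; lia.
have c_le : c <= (a0 + 1) * h.
  rewrite -(@ler_pXn2r _ 2) ?nnegrE ?mulr_ge0 ?(ltW c0) ?(ltW h0) //; last lia.
  rewrite exprMn c2 (@le_trans _ _ ((f + 1) * h ^+ 2)) ?ler_pM2r //; lia.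
have fh1 : 1 * h <= (f - a0 ^+ 2) * h by rewrite ler_pM2r //; lia.
have fh2 : (f - a0 ^+ 2) * h <= (2 * a0) * h by rewrite ler_pM2r //; lia.
have a0h : 1 * h <= a0 * h by rewrite ler_pM2r.
by apply: cf_act_surj; lia.
Qed.

Lemma period_word_pell (R : realType) (r : R) (f a0 c h : int) (a : seq int) :
  irrational_num r -> r ^+ 2 = f%:~R -> 1 < r + a0%:~R ->
  1 <= a0 -> a0 ^+ 2 < f -> f < (a0 + 1) ^+ 2 ->
  pos_word (2 * a0 :: a) -> cf_eval (2 * a0 :: a) (r + a0%:~R) = r + a0%:~R ->
  ~~ odd (size a) -> minimal_block (rcons a (2 * a0)) ->
  fundamental_solution f c h ->
  exists p q : int, [/\ 0 < p, 0 < q, c = 2 * p ^+ 2 + 1, h = 2 * p * q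
    & [/\ p ^+ 2 + 1 = f * q ^+ 2, cf_act (2 * a0 :: a) (1, 0) = (p + a0 * q, q)
    & cf_act (2 * a0 :: a) (0, 1) = ((f - a0 ^+ 2) * q, p - a0 * q)]].
Proof.
move=> rI r2 y1 a01 lf fu; set s := 2 * a0 :: a => sp sy aE smin [chS chM].
have [w [wp wN w1 w2]] := pell_unit_word a01 lf fu chS.
have wy : cf_eval w (r + a0%:~R) = r + a0%:~R.
  apply: (@cf_eval_fix R f) => //; first exact: ltW.
    by rewrite w1 w2 /=; ring.
  by rewrite w1 w2.
have comm : s ++ w = w ++ s.
  apply: (@cf_eval_inj R _ _ (r + a0%:~R)) => //.
  - by rewrite /pos_word all_cat; apply/andP.
  - by rewrite /pos_word all_cat; apply/andP.
  - by rewrite !size_cat addnC.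
  - by rewrite !cf_eval_cat wy sy wy.
(* The word [s] is the periodic block rotated by one place, and rotations commute. *)
have prim d : (0 < d < size s)%N -> rot d s != s.
  move=> ds; apply/negP => /eqP ss.
  have := @minimal_block_rot (rot 1 s) d; rewrite rot1_cons size_rcons => /(_ smin ds).
  by rewrite -rot1_cons rot_rot ss eqxx.
have [k wE] := comm_cat_primitive (isT : (0 < size s)%N) prim comm.
have sdet := cf_act_det s; have wdet := cf_act_det w.
have [sA sB] := cf_eval_quad rI r2 (ltW y1) sp sy.
have [A0 C0] := @cf_act_ge0 s 1 0 sp isT (lexx _).
have [B0 E0] := @cf_act_ge0 s 0 1 sp (lexx _) isT.
have C1 : 1 <= (cf_act s (1, 0)).2 by apply: cf_act10_ge1; case/andP: sp.
have sz : (-1) ^+ size s = -1 :> int by rewrite exprS -signr_odd (negbTE aE) mulr1.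
(* Exponent 0 would make [w] empty; exponent 1 would give determinant -1, while that of [w] is 1. *)
have [k' kE] : exists k', k = k'.+2.
  case: k wE => [|[|k]] wE; [by rewrite wE in wN| |by exists k].
  move: wdet; rewrite w1 w2 wE [flatten _]cats0 sz /=.
  by case: chS => _ _; lia.
clearbody s.
have [v wv] : exists v, w = s ++ (s ++ v) by exists (flatten (nseq k' s)); rewrite wE kE.
have vp : pos_word v by move: wp; rewrite wv /pos_word !all_cat => /and3P[].
move: w1; rewrite wv !cf_act_cat.
have v1 := cf_act10_ge1 vp; have [_ v2] := @cf_act_ge0 v 1 0 vp isT (lexx _).
move: v1 v2; case: (cf_act v (1, 0)) => x y /= x1 y0.
move: (cf_act_linear s) sdet sA sB A0 C0 B0 E0 C1; rewrite sz.
case: (cf_act s (1, 0)) (cf_act s (0, 1)) => [A q] [B E] /=.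
move=> lin det AE BE A0 q0 B0 E0 q1; rewrite !lin /= => -[_ hE].
pose p := E + a0 * q; have p0 : 0 < p by rewrite ltr_wpDl // mulr_gt0 //; lia.
have pq : p ^+ 2 + 1 = f * q ^+ 2.
  by move: det; rewrite AE BE /p => /eqP; rewrite -subr_eq0 => /eqP det;
    apply/eqP; rewrite -subr_eq0 -det; apply/eqP; ring.
have pell2 : pell_solution f (2 * p ^+ 2 + 1) (2 * p * q).
  split; [by rewrite ltr_wpDl // mulr_ge0 // sqr_ge0 | by rewrite !mulr_gt0 |].
  have -> : f * (2 * p * q) ^+ 2 = 4 * p ^+ 2 * (f * q ^+ 2) by ring.
  by rewrite -pq; ring.
have [_ h_le] := chM _ _ pell2.
(* The lower left entry of the matrix of [s ++ s] is [q (A + E) = 2 p q], and appending [v] cannot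
   decrease it. *)
have h_ge : 2 * p * q <= h.
  have -> : h = 2 * p * q + ((q * A + E * q) * (x - 1) + (q * B + E * E) * y).
    by rewrite -hE AE /p; ring.
  by rewrite lerDl addr_ge0 // mulr_ge0 ?subr_ge0 // addr_ge0 // mulr_ge0.
have {h_le h_ge} h_eq : h = 2 * p * q by lia.
exists p, q; split=> //.
- case: chS pell2 => c0 _ ch [P0 _]; rewrite -h_eq => PE.
  by apply/eqP; rewrite -(@eqrXn2 _ 2) ?(ltW c0) ?(ltW P0) //; lia.
- by split=> //; rewrite ?AE ?BE /p; congr pair; ring.
Qed.

(** The tail after [a0] exceeds 1, so [a0 < r < a0 + 1]; positivity of the block entry [2 a0] gives
    [1 <= a0]. *)
Lemma cf_eval_sqrt_bounds (R : realType) (f a0 : int) (a : seq int) (r : R) :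
  0 < r -> r ^+ 2 = f%:~R -> pos_word (rcons a (2 * a0)) ->
  r = cf_eval (a0 :: a) (r + a0%:~R) ->
  [/\ 1 <= a0, a0 ^+ 2 < f & f < (a0 + 1) ^+ 2].
Proof.
move=> r0 r2; rewrite /pos_word all_rcons => /andP[a0p ap] rE.
have a01 : 1 <= a0 by lia.
have a01R : 1 <= a0%:~R :> R by rewrite (ler_int R 1).
have z1 : 1 < cf_eval a (r + a0%:~R) by apply: cf_eval_gt1 => //; lra.
have zV : 0 < (cf_eval a (r + a0%:~R))^-1 < 1 by rewrite invr_gt0 invf_lt1; lra.
have {}rE : a0%:~R < r < a0%:~R + 1 by move: rE => /= rE; lra.
split=> //; rewrite -(ltr_int R) -r2 !expr2 rmorphM /= ?rmorphD /=; nra.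
Qed.

(** * The family of radicands and its Pell equation *)

Lemma sqrt_pell_family_cf (R : realType) (f a0 c h t p q : int) (a : seq int) :
  0 < f -> 1 <= a0 -> 0 < p -> 0 < q -> 0 <= t -> pos_word (2 * a0 :: a) ->
  c = 2 * p ^+ 2 + 1 -> h = 2 * p * q ->
  cf_act (2 * a0 :: a) (1, 0) = (p + a0 * q, q) ->
  cf_act (2 * a0 :: a) (0, 1) = ((f - a0 ^+ 2) * q, p - a0 * q) ->
  is_periodic_cf (Num.sqrt ((pell_family f c h t)%:~R : R))
    ((c + 1) * h * t + a0)
    (rcons a (2 * (c + 1) * h * t + 2 * a0)).
Proof.
move=> f0 a01 p0 q0 t0 /= /andP[_ ap] cE hE s1 s2.
set D := pell_family f c h t; set T := (c + 1) * h * t.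
have c0 : 0 < c by rewrite cE ltr_wpDl // mulr_ge0 // sqr_ge0.
have h0 : 0 < h by rewrite hE !mulr_gt0.
have T0 : 0 <= T by rewrite !mulr_ge0 //; lia.
have D0 : 0 < D.
  rewrite ltr_wpDl // addr_ge0 //; first by rewrite -!exprMn sqr_ge0.
  by rewrite mulr_ge0 // mulr_ge0 // subr_ge0 exprn_ege1 // -gtz0_ge1.
have D2 : Num.sqrt (D%:~R : R) ^+ 2 = D%:~R by rewrite sqr_sqrtr // ler0z ltW.
have : 0 < Num.sqrt (D%:~R : R) by rewrite sqrtr_gt0 ltr0z.
move: (Num.sqrt _) D2 => x x2 x0.
have b1 : 1 <= (T + a0)%:~R :> R by rewrite (ler_int R 1); lia.
pose y := x + (T + a0)%:~R; have y1 : 1 < y by rewrite /y; lra.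
apply: (@is_periodic_cf_intro _ _ _ _ _ y) => //.
- by rewrite /pos_word all_rcons; apply/andP; split; [rewrite /T in T0; lia | exact: ap].
- have z1 := cf_eval_ge1 ap (ltW y1); have zE := cf_evalE ap (ltW y1).
  have [B1_ge0 _] := @cf_act_ge0 a 0 1 ap (lexx _) isT.
  move: s1 s2 zE B1_ge0 z1 => /=.
  case: (cf_act a (1, 0)) (cf_act a (0, 1)) (cf_eval a y) => [A1 C1] [B1 E1] z /=.
  case=> A1E A1q [B1E B1q] zE B1_ge0 z1.
  (* This is the upper right entry relation of a fixed point, for the word with [a0] shifted by [T];
     it reduces to [q (c - 1) = h p]. *)
  have idE : q * (D - (T + a0) ^+ 2) = 2 * (T + a0) * B1 + E1.
    have -> : E1 = (f - a0 ^+ 2) * q - 2 * a0 * B1 by lia.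
    by rewrite B1q /D /T /pell_family cE hE; ring.
  clearbody D T.
  have C1E : C1 = B1 by lia.
  have num0 : 0 < q%:~R * y + B1%:~R.
    by rewrite ltr_wpDr ?ler0z // mulr_gt0 ?ltr0z //; lra.
  have denE : (x - (T + a0)%:~R) * (q%:~R * y + B1%:~R) = C1%:~R * y + E1%:~R.
    move: (congr1 (fun k : int => k%:~R : R) idE).
    rewrite /y C1E expr2 !(rmorphB, rmorphD, rmorphM) /= -x2 => idER.
    by apply/eqP; rewrite -subr_eq0; move/eqP: idER; rewrite -subr_eq0 => /eqP <-;
      apply/eqP; ring.
  move: zE; rewrite -denE A1q mulrA => zE.
  have zx : z * (x - (T + a0)%:~R) = 1.
    by apply: (mulIf (lt0r_neq0 num0)); rewrite mul1r.
  have z0 : z != 0 := lt0r_neq0 (lt_le_trans ltr01 z1).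
  have -> : z^-1 = x - (T + a0)%:~R by rewrite -[RHS](mulKf z0) zx mulr1.
  by rewrite addrC subrK.
- by rewrite /y /T !(rmorphD, rmorphM) /=; ring.
Qed.

Theorem theorem4 (R : realType) (f : int) (n : nat) (a0 : int)
    (a : n.-tuple int) (c h : int)
    (f_gt0 : 0 < f)
    (f_nonsquare : ~ exists m : int, f = m ^+ 2)
    (n_even : ~~ odd n)
    (sqrt_f : is_periodic_cf (Num.sqrt (f%:~R : R)) a0 (rcons a (2 * a0)))
    (period : minimal_block (rcons a (2 * a0)))
    (ch_fund : fundamental_solution f c h)
    (t : int) (t_ge0 : 0 <= t) :
  is_periodic_cf (Num.sqrt ((pell_family f c h t)%:~R : R))
    ((c + 1) * h * t + a0)
    (rcons a (2 * (c + 1) * h * t + 2 * a0))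
  /\ exists X Y : int,
      [/\ X%:Q = (c%:Q + 1) ^+ 2 / (c%:Q - 1) * h%:Q ^+ 4 * t%:Q ^+ 2
                 + 2 * (c%:Q + 1) * h%:Q ^+ 2 * t%:Q + c%:Q,
          Y%:Q = (c%:Q + 1) / (c%:Q - 1) * h%:Q ^+ 3 * t%:Q + h%:Q
        & fundamental_solution (pell_family f c h t) X Y].
Proof.
set r := Num.sqrt (f%:~R : R).
have rI : irrational_num r by move=> u v; exact: nonsquare_lin_indep.
have r2 : r ^+ 2 = f%:~R by rewrite sqr_sqrtr // ler0z ltW.
have r0 : 0 < r by rewrite sqrtr_gt0 ltr0z.
have rE := cf_sqrt_fix rI sqrt_f.
have ap : pos_word (rcons a (2 * a0)) by case: sqrt_f => _ /allP.
have [a01 lf fu] := cf_eval_sqrt_bounds r0 r2 ap rE.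
have sp : pos_word (2 * a0 :: a) by move: ap; rewrite /pos_word all_rcons.
have y1 : 1 < r + a0%:~R.
  by have : 1 <= a0%:~R :> R; [rewrite (ler_int R 1) | lra].
have sy : cf_eval (2 * a0 :: a) (r + a0%:~R) = r + a0%:~R.
  by rewrite [in RHS]rE /= intrM; ring.
have aE : ~~ odd (size a) by rewrite size_tuple.
have [p [q [p0 q0 cE hE [pq s1 s2]]]] :=
  period_word_pell rI r2 y1 a01 lf fu sp sy aE period ch_fund.
split; first exact: (sqrt_pell_family_cf R f_gt0 a01 p0 q0 t_ge0 sp cE hE s1 s2).
(* [P + q sqrt (f(t))] has norm -1, and its square is the pair sought. *)
pose P := p + (c + 1) * h * t * q.
exists (2 * P ^+ 2 + 1), (2 * P * q).
have p0Q : p%:Q != 0 by rewrite intr_eq0; lia.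
split.
(* The denominator [c - 1] becomes [2 p^2], which is nonzero. *)
- by rewrite /P cE hE; field; rewrite addrK !mulf_neq0.
- by rewrite /P cE hE; field; rewrite addrK !mulf_neq0.
(* At [t = 0] the bound [q^2 <= P] may fail, but the claim is then the hypothesis on [(c, h)]. *)
have [t_0|t_neq0] := eqVneq t 0.
  have -> : pell_family f c h t = f by rewrite /pell_family t_0; ring.
  have -> : P = p by rewrite /P t_0; ring.
  by rewrite -cE -hE.
apply: neg_pell_fundamental => //.
- have T_ge : q <= (c + 1) * h * t.
    rewrite cE hE (_ : _ * t = ((2 * p ^+ 2 + 2) * (2 * p) * t) * q); last by ring.
    by rewrite ler_peMl ?(ltW q0) // -gtz0_ge1 !mulr_gt0 //; nia.
  by rewrite expr2 /P ler_wpDl ?(ltW p0) // ler_wpM2r // ltW.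
- have -> : P ^+ 2 - pell_family f c h t * q ^+ 2 = p ^+ 2 - f * q ^+ 2.
    by rewrite /P /pell_family cE hE; ring.
  by rewrite -pq; ring.
Qed.
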